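(* ${\rm ic}(C_n\bar{C}_n)=\frac{7}{9}n+\Theta(1)$ for $n\ge 3$; that is, there is a constant $c$ such that $\left|{\rm ic}(C_n\bar{C}_n)-\frac{7}{9}n\right|\le c$ for every integer $n\ge 3$.
   Context: $C_n$ is the cycle of order $n$. The complementary prism $H\bar{H}$ of a graph $H$ with vertices $v_1,\ldots,v_n$ is the disjoint union of $H$ and its complement $\bar H$ (on vertices $\bar v_1,\ldots,\bar v_n$, where $\bar v_i\bar v_j$ is an edge iff $v_iv_j$ is not an edge of $H$) together with the perfect matching $v_1\bar v_1,\ldots,v_n\bar v_n$. A set $D$ of vertices of a graph $G$ is an identifying code if the sets $N_G[u]\cap D$ (where $N_G[u]$ is the closed neighborhood of $u$) are non-empty and pairwise distinct over all vertices $u$ of $G$; ${\rm ic}(G)$ denotes the minimum order of an identifying code in $G$. *)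

(* Defs.v *)
From mathcomp Require Import all_boot.

Set Implicit Arguments.
Unset Strict Implicit.
Unset Printing Implicit Defensive.

(* A finite simple graph is an irreflexive symmetric relation on a finType. *)

Section Graphs.
Variables (T : finType) (e : rel T).

Definition closed_nbhd (u : T) : {set T} := [set v | (v == u) || e u v].

Definition identifying_code (D : {set T}) : bool :=
  [forall u, closed_nbhd u :&: D != set0] &&
  [forall u, forall v,
     (u != v) ==> (closed_nbhd u :&: D != closed_nbhd v :&: D)].

(* When no identifying code exists (i.e. two vertices have the same closed
   neighborhood), [ic] takes the junk value #|T|. *)
Definition ic : nat :=
  #|[arg min_(D < [set: T] | identifying_code D) #|D|]|.

Definition compl_rel : rel T := [rel u v | (u != v) && ~~ e u v].

(* [inl v] is the vertex v of the graph, [inr v] is its copy in the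
   complement. *)
Definition compl_prism : rel (T + T) := fun x y =>
  match x, y with
  | inl u, inl v => e u v
  | inr u, inr v => compl_rel u v
  | inl u, inr v | inr u, inl v => u == v
  end.

Lemma identifying_codeT :
  injective closed_nbhd -> identifying_code [set: T].
Proof.
move=> inj; apply/andP; split.
  by apply/forallP=> u; apply/set0Pn; exists u; rewrite !inE eqxx.
apply/forallP=> u; apply/forallP=> v; apply/implyP; apply: contraNN.
by rewrite !setIT => /eqP /inj ->.
Qed.

Lemma ic_attained (D : {set T}) : identifying_code D ->
  exists2 D0 : {set T}, identifying_code D0 & #|D0| = ic.
Proof.
move=> codeD; suff codeT : identifying_code [set: T].
  by rewrite /ic; case: arg_minnP => // D0 codeD0 _; exists D0.
apply: identifying_codeT => u v eq_uv; apply/eqP; apply: contraT => neq_uv.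
case/andP: codeD => _ /forallP/(_ u)/forallP/(_ v).
by rewrite neq_uv eq_uv eqxx.
Qed.

Lemma ic_le (D : {set T}) : identifying_code D -> ic <= #|D|.
Proof.
move=> codeD; rewrite /ic; case: arg_minnP => [|D0 _]; last exact.
apply: identifying_codeT => u v eq_uv; apply/eqP; apply: contraT => neq_uv.
case/andP: codeD => _ /forallP/(_ u)/forallP/(_ v).
by rewrite neq_uv eq_uv eqxx.
Qed.

End Graphs.

(* C_n on the vertex set Z/nZ. This is a simple graph, the cycle of order n,
   only for n >= 3. *)
Definition cycle_graph (n : nat) : rel 'I_n :=
  [rel i j | (j == ordS i) || (i == ordS j)].

Lemma cycle_graph_sym n : symmetric (@cycle_graph n).
Proof. by move=> i j; rewrite /cycle_graph /= orbC. Qed.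

Lemma ordS_neq n (i : 'I_n) : 1 < n -> i != ordS i.
Proof.
move=> n_gt1; rewrite -val_eqE /=; have lt_in := ltn_ord i.
have [lt_Sin|] := ltnP i.+1 n; first by rewrite modn_small // ltn_eqF.
move=> le_nSi; have eq_n : i.+1 = n by apply/eqP; rewrite eqn_leq lt_in.
rewrite eq_n modnn; apply: contraTneq n_gt1 => i0.
by rewrite -eq_n i0.
Qed.

Lemma cycle_graph_irr n : 1 < n -> irreflexive (@cycle_graph n).
Proof.
by move=> n_gt1 i; rewrite /cycle_graph /= orbb (negbTE (ordS_neq i n_gt1)).
Qed.

Lemma compl_prism_sym (T : finType) (e : rel T) :
  symmetric e -> symmetric (compl_prism e).
Proof.
move=> sym_e [u|u] [v|v] //=; rewrite 1?eq_sym //.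
by rewrite /compl_rel /= eq_sym sym_e.
Qed.

Lemma compl_prism_irr (T : finType) (e : rel T) :
  irreflexive e -> irreflexive (compl_prism e).
Proof. by move=> irr_e [u|u] //=; rewrite /compl_rel /= eqxx. Qed.

(* In particular [ic] does not take its junk value in the case of interest. *)
Lemma compl_prism_cycle_code n : 2 < n ->
  identifying_code (compl_prism (@cycle_graph n)) setT.
Proof.
move=> n_gt2; have n_gt1 := ltnW n_gt2.
have key u v : closed_nbhd (compl_prism (@cycle_graph n)) (inl u) !=
               closed_nbhd (compl_prism (@cycle_graph n)) (inr v).
  apply/eqP=> /setP E.
  have /= := E (inl u); have /= := E (inl (ordS u)).
  rewrite !inE /= /cycle_graph /= eqxx /= orbT => /esym/eqP ->.
  by rewrite eqxx => /esym/eqP/esym/eqP; rewrite (negbTE (ordS_neq u n_gt1)).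
apply: identifying_codeT => [[u|u] [v|v]] E.
- have /setP/(_ (inr u)) := E; rewrite !inE /= eqxx => /esym/eqP.
  by move=> ->.
- by case/eqP: (key u v).
- by case/eqP: (key v u).
have /setP/(_ (inl u)) := E; rewrite !inE /= eqxx => /esym/eqP.
by move=> ->.
Qed.

(* Main.v *)
(** Write x_i, y_i for membership in the code D of v_i and of its copy in the
    complement. The vertices v_i and v_j at distance at least 3 are separated
    as soon as both are dominated; a complement vertex sees all the y's except
    y_{i-1} and y_{i+1}. Hence, up to one exceptional index, D is an identifying
    code exactly when finitely many disjunctions hold in each window of five
    consecutive positions, and the problem becomes the minimum mean weight of a
    cycle in a finite transition graph, which is 7/9. Shortest walks in that
    graph for the costs 9 * weight - 7 provide a potential; summed around the
    cycle, it telescopes to the lower bound. The word with x_i = 1 for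
    i mod 9 in {0,1,2} and y_i = 1 for i mod 9 in {4,5,6,7} attains the
    density 7/9. *)

Require Import Defs.
From mathcomp Require Import all_boot all_order all_algebra.
From mathcomp Require Import zify lra.

Set Implicit Arguments.
Unset Strict Implicit.
Unset Printing Implicit Defensive.

Import Order.TTheory GRing.Theory Num.Theory.
Local Open Scope ring_scope.

(** * Binary windows and the potential on them *)

Section Words.
Local Open Scope nat_scope.

Fixpoint words (n : nat) : seq bitseq :=
  if n is m.+1 then [seq b :: w | b <- [:: false; true], w <- words m]
  else [:: [::]].

Lemma mem_words (w : bitseq) : w \in words (size w).
Proof.
elim: w => //= b w IHw; rewrite !mem_cat.
by case: b; rewrite (map_f (cons _)) ?orbT.
Qed.

(* A window lists x_0, y_0, ..., x_4, y_4. The five conditions say that v_1 is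
   dominated, that v_1, v_2 and then v_1, v_3 are separated, that the trace of
   the copy of v_1 is not exactly the set of all code vertices of the complement
   (which may fail once), and that the copies of v_1 and v_3 are separated. *)
Definition admissible (w : bitseq) : bool :=
  if w is [:: x0; y0; x1; y1; x2; y2; x3; y3; x4; y4] then
    [&& [|| x0, x1, x2 | y1], [|| x0, x3, y1 | y2],
        [|| x0, x1, x3, x4, y1 | y3], [|| y0, x1 | y2]
      & [|| x1, x3, y0 | y4]]
  else false.

Definition binary (w : bitseq) : nat :=
  foldl (fun (c : nat) (b : bool) => c.*2 + b) 0 w.

(* One Bellman-Ford round for the costs [9 * weight - 7] on the graph whose
   vertices are the words of length 8 and whose edges are admissible windows. *)
Definition relax (t : seq nat) : seq nat :=
  [seq foldr minn (nth 0 t (binary s))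
     [seq nth 0 t (binary (take 8 (h ++ s)))
          + 9 * count id (drop 6 s) - 7
     | h <- words 2 & admissible (h ++ s)]
  | s <- words 8].

(* The offset 28 keeps all values above the truncation of [-] at 0, and 14
   rounds are enough to reach the fixed point. *)
Definition potential_table : seq nat := iter 14 relax (nseq 256 28).

Definition potential (w : bitseq) : nat := nth 0 potential_table (binary w).

(** Evaluation on all 1024 words of length 10 certifies the final table directly, however it was
    computed. *)
Lemma potential_step (w : bitseq) : admissible w ->
  potential (drop 2 w) + 7
    <= potential (take 8 w) + 9 * count id (drop 8 w).
Proof.
move=> adm_w; have size_w : size w = 10.
  by move: adm_w; do 11![case: w => // ? w].
have : all (fun w => admissible w ==>
    (nth 0 potential_table (binary (drop 2 w)) + 7
    <= nth 0 potential_table (binary (take 8 w)) + 9 * count id (drop 8 w)))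
    (words 10).
  by vm_compute.
move/allP/(_ w); rewrite -size_w mem_words => /(_ isT)/implyP; exact.
Qed.

End Words.

(** * Identifying codes through single witnesses *)

Section IdentifyingCodes.
Local Open Scope nat_scope.
Variables (T : finType) (e : rel T).
Implicit Types (D : {set T}) (u v w : T).

Lemma identifying_codeP D :
  reflect ((forall u, exists2 w, w \in D & w \in closed_nbhd e u) /\
           (forall u v, u != v -> exists2 w, w \in D &
              (w \in closed_nbhd e u) != (w \in closed_nbhd e v)))
          (identifying_code e D).
Proof.
apply: (iffP andP) => [[/forallP dom /forallP sep]|[dom sep]]; split.
- by move=> u; have /set0Pn[w /setIP[]] := dom u; exists w.
- move=> u v neq_uv; have /forallP/(_ v)/implyP/(_ neq_uv) := sep u.
  have [/exists_inP[w Dw Nw] _|] := boolP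
    [exists w in D, (w \in closed_nbhd e u) != (w \in closed_nbhd e v)].
    by exists w.
  rewrite negb_exists_in => /forall_inP no_sep /eqP[].
  apply/setP => w; rewrite !in_setI.
  have [/no_sep/negPn/eqP->|] := boolP (w \in D); first by [].
  by rewrite !andbF.
- apply/forallP=> u; have [w Dw Nw] := dom u.
  by apply/set0Pn; exists w; rewrite in_setI Nw.
apply/forallP=> u; apply/forallP=> v; apply/implyP=> /sep[w Dw].
by apply: contraNN => /eqP/setP/(_ w); rewrite !in_setI Dw !andbT => ->.
Qed.

Lemma identifying_code_sub D D' :
  D \subset D' -> identifying_code e D -> identifying_code e D'.
Proof.
move=> /subsetP sDD' /identifying_codeP[dom sep].
apply/identifying_codeP; split=> [u|u v /sep[w Dw Nw]].
  by have [w /sDD' Dw Nw] := dom u; exists w.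
by exists w; rewrite ?sDD'.
Qed.

End IdentifyingCodes.

Lemma card_sum_set (T : finType) (D : {set T + T}) :
  (#|D| = \sum_(i : T) ((inl i \in D) + (inr i \in D)))%N.
Proof.
rewrite -sum1_card big_mkcond big_sumType big_split /=.
by congr addn; apply: eq_bigr => i _; case: ifP.
Qed.

(** * Windows around the cycle and the lower bound *)

Section Cycle.
Local Open Scope nat_scope.
Variable n : nat.
Implicit Types (D : {set 'I_n + 'I_n}) (i j k p : 'I_n).

Local Notation s := (@ordS n).
Local Notation N := (closed_nbhd (compl_prism (@cycle_graph n))).
Local Notation code := (identifying_code (compl_prism (@cycle_graph n))).

Hypothesis n_gt2 : 2 < n.

Lemma in_nbhd_ll i k :
  (inl k \in N (inl (s i))) = [|| k == i, k == s i | k == s (s i)].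
Proof.
rewrite inE /= /cycle_graph /= (inj_eq inl_inj) (inj_eq (@ordS_inj n)).
by rewrite [i == k]eq_sym orbA orbC.
Qed.

Lemma in_nbhd_lr i k : (inr k \in N (inl i)) = (k == i).
Proof. by rewrite inE /= eq_sym. Qed.

Lemma in_nbhd_rl i k : (inl k \in N (inr i)) = (k == i).
Proof. by rewrite inE /= eq_sym. Qed.

Lemma in_nbhd_rr i k :
  (inr k \in N (inr (s i))) = (k != i) && (k != s (s i)).
Proof.
rewrite inE /= /compl_rel /= /cycle_graph /= (inj_eq inr_inj).
rewrite (inj_eq (@ordS_inj n)) [i == k]eq_sym [s i == k]eq_sym.
have [->|_] := eqVneq k (s i); last by rewrite /= negb_or andbC.
by rewrite /= [s i == i]eq_sym !(negPf (ordS_neq _ (ltnW n_gt2))).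
Qed.

Definition in_nbhd := (in_nbhd_ll, in_nbhd_lr, in_nbhd_rl, in_nbhd_rr).

Lemma val_iter_ordS a i : val (iter a s i) = (i + a) %% n.
Proof.
elim: a => [|a IHa] /=; first by rewrite addn0 modn_small.
by rewrite IHa -addn1 modnDml addn1 addnS.
Qed.

Lemma eq_iter_ordS a b i : a < n -> b < n ->
  (iter a s i == iter b s i) = (a == b).
Proof.
move=> a_n b_n; rewrite -val_eqE !val_iter_ordS eqn_modDl.
by rewrite !modn_small.
Qed.

Definition window D i : bitseq :=
  flatten [seq [:: inl j \in D; inr j \in D] | j <- traject s i 5].

Lemma drop_window D i : drop 2 (window D i) = take 8 (window D (s i)).
Proof. by []. Qed.

(** Each window pays only for its last position, so summing [potential_step] over all [i] counts
    every code vertex once; rotation permutes the indices, so the potentials cancel. *)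
Lemma admissible_card D :
  (forall i, admissible (window D i)) -> 7 * n <= 9 * #|D|.
Proof.
move=> adm; pose f i := potential (take 8 (window D i)).
have reindexS a (F : 'I_n -> nat) : \sum_i F (iter a s i) = \sum_i F i.
  rewrite [RHS](@reindex_inj _ _ _ _ (iter a s)) //.
  by elim: a => [|a IHa] i j //= /ordS_inj/IHa.
pose F i := (inl i \in D) + (inr i \in D).
have: \sum_i (f (s i) + 7) <= \sum_i (f i + 9 * F (iter 4 s i)).
  apply: leq_sum => i _; rewrite /f -drop_window.
  by apply: leq_trans (potential_step (adm i)) _; rewrite /= addn0.
rewrite big_split [leqRHS]big_split /= (reindexS 1) leq_add2l.
rewrite sum_nat_const card_ord mulnC.
by rewrite -big_distrr card_sum_set (reindexS 4).
Qed.

Lemma neqD D (f : 'I_n -> 'I_n + 'I_n) k j :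
  f k \in D -> f j \notin D -> (k == j) = false.
Proof. by move=> Dk; apply: contraNF => /eqP <-. Qed.

(** If a disjunction fails, no code vertex lies where the two closed neighborhoods differ, or none
    dominates. *)
Lemma code_window D i : code D ->
  [|| inr i \in D, inl (s i) \in D | inr (s (s i)) \in D] ->
  admissible (window D i).
Proof.
move=> /identifying_codeP[dom sep] C1.
have neq1 := ordS_neq _ (ltnW n_gt2).
have neq2 j : j != s (s j).
  by rewrite (@eq_iter_ordS 0 2) // ltnW // ltnW.
rewrite /admissible /=; apply/and5P; split=> //; apply: contraT.
- rewrite !negb_or => /and4P[x0 x1 x2 y1].
  have [[k|k] Dk] := dom (inl (s i)).
    by rewrite in_nbhd (neqD Dk x0) (neqD Dk x1) (neqD Dk x2).
  by rewrite in_nbhd (neqD Dk y1).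
- rewrite !negb_or => /and4P[x0 x3 y1 y2].
  have [[k|k] Dk] := sep (inl (s i)) (inl (s (s i))) (neq1 _).
    rewrite !in_nbhd.
    rewrite (neqD Dk x0) (neqD Dk x3).
    by rewrite orbF eqxx.
  rewrite !in_nbhd.
  by rewrite (neqD Dk y1) (neqD Dk y2).
- rewrite !negb_or => /and5P[x0 x1 x3 x4 /andP[y1 y3]].
  have [[k|k] Dk] := sep (inl (s i)) (inl (s (s (s i)))) (neq2 _).
    rewrite !in_nbhd.
    rewrite (neqD Dk x0) (neqD Dk x1).
    rewrite (neqD Dk x3) (neqD Dk x4).
    by rewrite !orbF eqxx.
  rewrite !in_nbhd.
  by rewrite (neqD Dk y1) (neqD Dk y3).
rewrite !negb_or => /and4P[x1 x3 y0 y4].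
have [[k|k] Dk] := sep (inr (s i)) (inr (s (s (s i)))) (neq2 _).
  rewrite !in_nbhd.
  by rewrite (neqD Dk x1) (neqD Dk x3).
rewrite !in_nbhd.
rewrite (neqD Dk y0) (neqD Dk y4).
by rewrite andbT eqxx.
Qed.

(* A copy of v_i violating the fourth admissibility condition sees all code
   vertices of the complement and nothing else, so at most one exists, and
   adding v_i to the code repairs it. *)
Lemma code_extend D : code D ->
  exists2 D' : {set 'I_n + 'I_n}, #|D'| <= #|D|.+1 &
    forall i, admissible (window D' i).
Proof.
move=> codeD.
pose ok D i := [|| inr i \in D, inl (s i) \in D | inr (s (s i)) \in D].
have [all_ok|] := boolP [forall i, ok D i].
  exists D => // i; apply: code_window => //; exact: (forallP all_ok).
rewrite negb_forall => /existsP[i]; rewrite /ok !negb_or => /and3P[y0 x1 y2].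
exists (inl (s i) |: D) => [|j]; first by rewrite cardsU1; case: (_ \notin _).
apply: code_window.
  by apply: identifying_code_sub codeD; apply: subsetUr.
rewrite !in_setU1 (inj_eq inl_inj) (inj_eq (@ordS_inj n)) /=.
have [//|neq_ji] := eqVneq j i; first by rewrite orbT.
apply: contraT; rewrite !negb_or => /and3P[y0' x1' y2'].
have [_ /(_ (inr (s i)) (inr (s j)))[]] := identifying_codeP _ _ codeD.
  by rewrite (inj_eq inr_inj) (inj_eq (@ordS_inj n)) eq_sym.
case=> k Dk.
  rewrite !in_nbhd.
  by rewrite (neqD Dk x1) (neqD Dk x1').
rewrite !in_nbhd.
rewrite (neqD Dk y0) (neqD Dk y2).
by rewrite (neqD Dk y0') (neqD Dk y2').
Qed.

(** * From windows back to codes, and the periodic code *)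

Definition separated D (u v : 'I_n + 'I_n) :=
  exists2 w, w \in D & (w \in N u) != (w \in N v).

Lemma separatedC D u v : separated D u v -> separated D v u.
Proof. by case=> w Dw; rewrite eq_sym; exists w. Qed.

Lemma admissible_code D : 5 < n -> (forall i, admissible (window D i)) ->
  3 < #|[set k | inr k \in D]| -> code D.
Proof.
move=> n_gt5 adm many_inr.
have neqS d i : d < 5 -> (i == iter d.+1 s i) = false.
  by move=> d_lt5; rewrite (@eq_iter_ordS 0 d.+1) //; lia.
have neqSl d i : d < 5 -> (iter d.+1 s i == i) = false.
  by move=> d_lt5; rewrite eq_sym neqS.
have eqS := (inj_eq (@ordS_inj n), fun i => neqS 0 i isT,
  fun i => neqS 1 i isT, fun i => neqS 2 i isT, fun i => neqS 3 i isT,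
  fun i => neqSl 0 i isT, fun i => neqSl 1 i isT, fun i => neqSl 2 i isT,
  fun i => neqSl 3 i isT).
rewrite /= in eqS.
have dom_l p : exists2 w, w \in D & w \in N (inl (s p)).
  have /and5P[/or4P[]Dw _ _ _ _] := adm p; eexists; try exact: Dw;
  by rewrite in_nbhd eqxx ?orbT.
have sep_ll1 p : separated D (inl (s p)) (inl (s (s p))).
  have /and5P[_ /or4P[]Dw _ _ _] := adm p; eexists; try exact: Dw;
  by rewrite !in_nbhd !eqS !eqxx.
have sep_ll2 p : separated D (inl (s p)) (inl (s (s (s p)))).
  have /and5P[_ _ /or4P[Dw|Dw|Dw|/or3P[]Dw] _ _] := adm p;
  by eexists; first exact: Dw; rewrite !in_nbhd !eqS !eqxx.
have sep_rr2 p : separated D (inr (s p)) (inr (s (s (s p)))).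
  have /and5P[_ _ _ _ /or4P[]Dw] := adm p;
  by eexists; first exact: Dw; rewrite !in_nbhd !eqS !eqxx.
have ordSP i : exists p, i = s p by exists (ord_pred i); rewrite ord_predK.
have sep_ll i j : i != j -> separated D (inl i) (inl j).
  have [[p ->] [q ->]] := (ordSP i, ordSP j); rewrite eqS => neq_pq.
  (* A common dominator on the cycle forces distance at most 2, where the window conditions
     separate. *)
  have [w Dw Nw] := dom_l p.
  have [Nw'|] := boolP (w \in N (inl (s q))); last by exists w; rewrite ?Nw.
  case: w {Dw} Nw Nw' => k; rewrite !in_nbhd.
    case/or3P=> /eqP-> /or3P[]; rewrite ?eqS ?(negPf neq_pq) // => /eqP eq_pq.
    - by rewrite eq_pq; apply: separatedC.
    - by rewrite eq_pq; apply: separatedC.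
    - by rewrite -eq_pq.
    - by rewrite eq_pq; apply: separatedC.
    - by rewrite -eq_pq.
    by rewrite -eq_pq.
  by move=> /eqP->; rewrite eqS (negPf neq_pq).
have sep_rr i j : i != j -> separated D (inr i) (inr j).
  have [[p ->] [q ->]] := (ordSP i, ordSP j); rewrite eqS => neq_pq.
  (* Each possible witness separates the two copies, unless they are at distance 2 and [sep_rr2]
     applies. *)
  have /and5P[_ _ _ /or3P[]Dw _] := adm p.
  - have [Nw|] := boolP (inr p \in N (inr (s q))).
      by exists (inr p) => //; rewrite Nw in_nbhd eqxx.
    rewrite in_nbhd (negPf neq_pq) negbK => /eqP->.
    exact: separatedC.
  - by exists (inl (s p)) => //; rewrite !in_nbhd !eqS eqxx (negPf neq_pq).
  have [Nw|] := boolP (inr (s (s p)) \in N (inr (s q))).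
    by exists (inr (s (s p))) => //; rewrite Nw in_nbhd eqxx andbF.
  by rewrite in_nbhd !eqS (negPf neq_pq) andbT negbK => /eqP<-.
(* Only three indices must be avoided: [i] and the two cycle neighbors of [j]; four copies in [D]
   leave one. *)
have far i j : exists2 k, inr k \in D & (inr k \in N (inr j)) && (k != i).
  have [p ->] := ordSP j.
  have /subsetPn[k] : ~~ ([set k | inr k \in D] \subset [set i; p; s (s p)]).
    apply: contraTN many_inr => /subset_leq_card le_card; rewrite -leqNgt.
    apply: leq_trans le_card _; rewrite -setUA !cardsU1 cards1.
    by do 2!case: (_ \notin _).
  rewrite !inE -orbA !negb_or => Dk /and3P[neq_i neq_p neq_ssp].
  by exists k; rewrite // in_nbhd neq_p neq_ssp.
have sep_lr i j : separated D (inl i) (inr j).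
  have [k Dk /andP[Nk neq_ki]] := far i j; exists (inr k) => //.
  by rewrite Nk in_nbhd (negPf neq_ki).
apply/identifying_codeP; split=> [[i|i]|[i|i] [j|j] neq_ij].
- by have [p ->] := ordSP i; apply: dom_l.
- by have [k Dk /andP[Nk _]] := far i i; exists (inr k).
- exact: sep_ll.
- exact: sep_lr.
- exact/separatedC/sep_lr.
exact: sep_rr.
Qed.

(* Filling up both ends of [0, n[ makes the windows that go around the cycle
   admissible whatever n is modulo 9. *)
Definition periodic_code : {set 'I_n + 'I_n} :=
  [set u : 'I_n + 'I_n |
    match u with
    | inl i => [|| i < 4, n <= i + 4 | i %% 9 < 3]
    | inr i => [|| i < 4, n <= i + 4 | 3 < i %% 9 < 8]
    end].

Lemma periodic_code_admissible i : 5 < n ->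
  admissible (window periodic_code i).
Proof.
move=> n_gt5; have i_n := ltn_ord i; have val_ord a := val_iter_ordS a i.
have [wrap|no_wrap] := leqP n (i + 4).
  have full a : a < 5 -> (inl (iter a s i) \in periodic_code) &&
                         (inr (iter a s i) \in periodic_code).
    move=> a_lt5; rewrite !inE val_ord; case: (ltnP (i + a) n) => [lt_n|le_n].
      by rewrite modn_small //; lia.
    have -> : (i + a) %% n = i + a - n; last lia.
    by rewrite -{1}(subnK le_n) modnDr modn_small //; lia.
  have /andP[x0 y0] := full 0 isT; have /andP[x1 y1] := full 1 isT.
  have /andP[x2 y2] := full 2 isT; have /andP[x3 y3] := full 3 isT.
  by rewrite /= in x0 y0 x1 y1 x2 y2 x3 y3 *; rewrite x0 y0 x1 y1 x2 y2 x3.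
(* Implications suffice: admissibility is monotone, so vertices added at the ends do no harm. *)
have pat a : a < 5 -> let r := (i %% 9 + a) %% 9 in
    (r < 3 -> inl (iter a s i) \in periodic_code) /\
    (3 < r < 8 -> inr (iter a s i) \in periodic_code).
  move=> a_lt5 /=; rewrite modnDml !inE val_ord (@modn_small _ n); last lia.
  by split=> ->; rewrite !orbT.
have [[x0 y0] [x1 y1] [x2 y2]] := And3 (pat 0 isT) (pat 1 isT) (pat 2 isT).
have [[x3 y3] [x4 y4]] := (pat 3 isT, pat 4 isT).
have := ltn_pmod i (isT : 0 < 9).
move: (i %% 9) x0 y0 x1 y1 x2 y2 x3 y3 x4 y4 => r /=.
by do 9?[case: r => [|r]] => //= x0 y0 x1 y1 x2 y2 x3 y3 x4 y4 _;
  try rewrite (x0 isT); try rewrite (y0 isT); try rewrite (x1 isT);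
  try rewrite (y1 isT); try rewrite (x2 isT); try rewrite (y2 isT);
  try rewrite (x3 isT); try rewrite (y3 isT); try rewrite (x4 isT);
  try rewrite (y4 isT); rewrite ?orbT.
Qed.

Lemma sum_pattern m :
  \sum_(k < m) ((k %% 9 < 3) + (3 < k %% 9 < 8)) = 7 * m.+1 %/ 9.
Proof.
elim: m => [|m IHm]; first by rewrite big_ord0.
by rewrite big_ord_recr /= IHm; lia.
Qed.

(** Each filled end adds at most 8 vertices, and [sum_pattern] counts at most [7 * n.+1 %/ 9]: 151 =
    9 * 16 + 7. *)
Lemma card_periodic_code : 9 * #|periodic_code| <= 7 * n + 151.
Proof.
have head m : \sum_(k < m) (k < 4) <= 4.
  suff -> : \sum_(k < m) (k < 4) = minn m 4 by exact: geq_minr.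
  elim: m => [|m IHm]; first by rewrite big_ord0.
  by rewrite big_ord_recr /= IHm; lia.
have tail c m : \sum_(k < m) (c <= k + 4) = m - (c - 4).
  elim: m => [|m IHm]; first by rewrite big_ord0.
  by rewrite big_ord_recr /= IHm; lia.
rewrite card_sum_set.
have le_sum :
  \sum_(i < n) ((inl i \in periodic_code) + (inr i \in periodic_code))
  <= \sum_(i < n) (((i < 4) + (i < 4)) + ((n <= i + 4) + (n <= i + 4))
                  + ((i %% 9 < 3) + (3 < i %% 9 < 8))).
  apply: leq_sum => i _; rewrite !inE; lia.
move: le_sum (head n) (sum_pattern n); rewrite !big_split /= tail; lia.
Qed.

Lemma periodic_code_identifying : 5 < n -> code periodic_code.
Proof.
move=> n_gt5; apply: admissible_code => // [i|].
  exact: periodic_code_admissible.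
have n_ge4 : 4 <= n by lia.
have inj_widen : injective (widen_ord n_ge4).
  by move=> i j /(congr1 val) eq_ij; apply: val_inj.
rewrite -[4]card_ord -(card_imset _ inj_widen); apply/subset_leq_card.
by apply/subsetP => k /imsetP[i _ ->]; rewrite !inE /= ltn_ord.
Qed.

End Cycle.

Theorem theorem1 :
  exists c : rat, forall n : nat, (3 <= n)%N ->
    `| (ic (compl_prism (@cycle_graph n)))%:R - 7%:R / 9%:R * n%:R | <= c.
Proof.
(* The error is at most 151/9 < 17 from above and 1 from below. *)
exists 17%:R => n n_gt2.
have codeT := compl_prism_cycle_code n_gt2.
have lower : (7 * n <= 9 * (ic (compl_prism (@cycle_graph n))).+1)%N.
  have [D codeD <-] := ic_attained codeT.
  have [D' cardD' /admissible_card leD'] := code_extend n_gt2 codeD.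
  by apply: leq_trans leD' _; rewrite leq_mul2l cardD' orbT.
have upper : (9 * ic (compl_prism (@cycle_graph n)) <= 7 * n + 151)%N.
  have [n_gt5|n_le5] := ltnP 5 n.
    apply: leq_trans _ (card_periodic_code n_gt2); rewrite leq_mul2l.
    by apply: ic_le; apply: periodic_code_identifying.
  (* For [n <= 5] the whole vertex set, of size [2 * n], is small enough. *)
  have := ic_le codeT; rewrite cardsT card_sum card_ord; lia.
move: (ic _) lower upper => m lower upper.
have lowerQ : 7%:R * n%:R <= 9%:R * (m%:R + 1) :> rat.
  by rewrite natr1 -!natrM ler_nat.
have upperQ : 9%:R * m%:R <= 7%:R * n%:R + 151%:R :> rat.
  by rewrite -!natrM -natrD ler_nat.
rewrite ler_norml; apply/andP; split; lra.
Qed.
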